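(* Let $E$ and $F$ be Banach lattices. (1) If $E^\ast$ is a KB-space and the lattice operations of $F^\ast$ are $\mathrm{w}^\ast$-sequentially continuous, then every positive almost Dunford--Pettis operator $T:E\to F$ is limited. (2) If the lattice operations of $E^\ast$ are $\mathrm{w}^\ast$-sequentially continuous, then every M-weakly compact operator $T:E\to F$ is limited.
   Context: All vector spaces are real and all operators are linear and bounded. $B_X$ is the closed unit ball of $X$. The lattice operations of $E^\ast$ are $\mathrm{w}^\ast$-sequentially continuous if, for every sequence $(f_n)$ in $E^\ast$, $f_n\to 0$ in $\mathrm{w}^\ast$ implies $|f_n|\to 0$ in $\mathrm{w}^\ast$. A bounded subset $C$ of a Banach space $X$ is limited if every $\mathrm{w}^\ast$-null sequence in $X^\ast$ converges to zero uniformly on $C$; an operator $T:X\to Y$ is limited if $T(B_X)$ is a limited subset of $Y$. An operator $T:E\to F$ is almost Dunford--Pettis if it maps disjoint weakly null sequences to norm null sequences, and M-weakly compact if $\|Tx_n\|\to 0$ for every disjoint bounded sequence $(x_n)$ in $E$. A KB-space is a Banach lattice in which every norm bounded increasing sequence of positive elements is norm convergent. *)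

(* Defs.v *)
From HB Require Import structures.
From mathcomp Require Import all_boot all_order all_algebra.
From mathcomp Require Import boolp classical_sets functions reals topology.
From mathcomp Require Import normedtype sequences.

Set Implicit Arguments.
Unset Strict Implicit.
Unset Printing Implicit Defensive.

Import Order.TTheory GRing.Theory Num.Theory.
Import numFieldNormedType.Exports.

Local Open Scope classical_set_scope.
Local Open Scope ring_scope.

Definition unit_ball (R : realType) (X : normedModType R) : set X :=
  [set x | `|x| <= 1].

Arguments unit_ball {R} X.

Definition bounded_operator (R : realType) (X Y : normedModType R)
  (T : X -> Y) : Prop := linear T /\ bounded_near T (nbhs (0 : X)).

Section BoundedOperator.
Variables (R : realType) (X Y : normedModType R).

Lemma bounded_operatorP (T : X -> Y) : bounded_operator T <->
  linear T /\ exists2 M : R, 0 <= M & forall x, `|T x| <= M * `|x|.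
Proof.
split=> -[lT bT]; split=> //; pose Tl : {linear X -> Y} :=
  HB.pack T (GRing.isLinear.Build _ _ _ _ T lT).
- have /linear_boundedP/pinfty_ex_gt0 [M M0 TM] : bounded_near Tl (nbhs (0 : X)) by [].
  by exists M => //; exact: ltW.
- case: bT => M M0 TM; apply/(@linear_boundedP _ _ _ Tl).
  near=> r => x; apply: le_trans (TM x) _; rewrite ler_wpM2r//.
  by near: r; apply: nbhs_pinfty_ge; rewrite num_real.
Unshelve. all: by end_near. Qed.

End BoundedOperator.

Definition bounded_functional (R : realType) (X : normedModType R) :
  {pred X -> R^o} := mem [set f : X -> R^o | bounded_operator f].

Arguments bounded_functional {R} X.

Record dual (R : realType) (X : normedModType R) : Type := Dual {
  dual_fun :> X -> R^o;
  _ : dual_fun \in bounded_functional X }.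

Section DualNormed.
Variables (R : realType) (X : normedModType R).

HB.instance Definition _ := [isSub for @dual_fun R X].
HB.instance Definition _ := [Choice of dual X by <:].

Lemma bounded_functionalP (f : X -> R^o) : f \in bounded_functional X <->
  linear f /\ exists2 M : R, 0 <= M & forall x, `|f x| <= M * `|x|.
Proof.
by rewrite -bounded_operatorP /bounded_functional inE; split; rewrite ?inE.
Qed.

Fact bounded_functional_submod_closed : submod_closed (bounded_functional X).
Proof.
split; first (apply/bounded_functionalP; split; last exists 0 => // x).
- by move=> a x y /=; rewrite /GRing.zero /= scaler0 addr0.
- by rewrite normr0 mul0r.
move=> a f g /bounded_functionalP[lf [M M0 fM]] /bounded_functionalP[lg [N N0 gN]].
apply/bounded_functionalP; split=> [b x y|].
  have fctE (u : X) : (a *: f + g) u = a *: f u + g u by [].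
  rewrite !fctE lf lg !scalerDr !scalerA (mulrC a b) -!addrA; congr (_ + _).
  by rewrite addrCA.
exists (`|a| * M + N) => [|x]; first by rewrite addr_ge0 ?mulr_ge0.
rewrite (le_trans (ler_normD _ _))// mulrDl lerD//.
by rewrite normrZ -mulrA ler_wpM2l.
Qed.

HB.instance Definition _ := GRing.isSubmodClosed.Build R (X -> R^o)
  (bounded_functional X) bounded_functional_submod_closed.
HB.instance Definition _ := [SubChoice_isSubLmodule of dual X by <:].

Lemma dual_linear (f : dual X) : linear f.
Proof. by case: f => f /= /bounded_functionalP[]. Qed.

HB.instance Definition _ (f : dual X) :=
  GRing.isLinear.Build R X R^o *:%R (dual_fun f) (@dual_linear f).

Lemma dual_bounded (f : dual X) :
  exists2 M : R, 0 <= M & forall x, `|f x| <= M * `|x|.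
Proof. by case: f => f /= /bounded_functionalP[]. Qed.

Lemma dualD (f g : dual X) x : (f + g) x = f x + g x. Proof. by []. Qed.
Lemma dualN (f : dual X) x : (- f) x = - f x. Proof. by []. Qed.
Lemma dualZ a (f : dual X) x : (a *: f) x = a * f x. Proof. by []. Qed.
Lemma dual0 x : (0 : dual X) x = 0. Proof. by []. Qed.
Lemma dualP (f g : dual X) : (forall x, f x = g x) -> f = g.
Proof. by move=> fg; apply/val_inj/funext. Qed.

Implicit Types f g : dual X.

Definition dual_norm (f : dual X) : R :=
  sup [set `|f x : R| | x in unit_ball X].

Lemma dual_norm_has_sup f : has_sup [set `|f x : R| | x in unit_ball X].
Proof.
split; first by exists `|f 0 : R|, 0 => //; rewrite /unit_ball /= normr0.
have [M M0 fM] := dual_bounded f; exists M => _ [x x1 <-].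
by rewrite (le_trans (fM x))// ler_piMr.
Qed.

Lemma dual_norm_ge0 f : 0 <= dual_norm f.
Proof.
apply: (@le_trans _ _ `|f 0 : R|) => //.
apply: ub_le_sup; first by case: (dual_norm_has_sup f).
by exists 0 => //; rewrite /unit_ball /= normr0.
Qed.

Lemma ler_dual_norm f x : `|f x : R| <= dual_norm f * `|x|.
Proof.
have [->|x0] := eqVneq x 0; first by rewrite linear0 !normr0 mulr0.
rewrite -ler_pdivrMr ?normr_gt0//.
apply: ub_le_sup; first by case: (dual_norm_has_sup f).
exists (`|x|^-1 *: x).
  by rewrite /unit_ball /= normrZ normfV normr_id mulVf ?normr_eq0.
by rewrite linearZ /= normrM normfV normr_id mulrC.
Qed.

Lemma dual_norm_le f (M : R) : 0 <= M ->
  (forall x, `|f x : R| <= M * `|x|) -> dual_norm f <= M.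
Proof.
move=> M0 fM; apply: ge_sup; first by case: (dual_norm_has_sup f).
by move=> _ [x x1 <-]; rewrite (le_trans (fM x))// ler_piMr.
Qed.

Fact dual_normD f g : dual_norm (f + g) <= dual_norm f + dual_norm g.
Proof.
apply: dual_norm_le => [|x]; first by rewrite addr_ge0 ?dual_norm_ge0.
by rewrite dualD (le_trans (ler_normD _ _))// mulrDl lerD ?ler_dual_norm.
Qed.

Fact dual_normZ a f : dual_norm (a *: f) = `|a| * dual_norm f.
Proof.
have le b g : dual_norm (b *: g) <= `|b| * dual_norm g.
  apply: dual_norm_le => [|x]; first by rewrite mulr_ge0 ?dual_norm_ge0.
  by rewrite dualZ normrM -mulrA ler_wpM2l ?ler_dual_norm.
apply/eqP; rewrite eq_le le /=.
have [->|a0] := eqVneq a 0; first by rewrite normr0 mul0r dual_norm_ge0.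
rewrite mulrC -ler_pdivlMr ?normr_gt0// mulrC -normfV.
by rewrite -{1}[f](scalerK a0) le.
Qed.

Fact dual_norm0_eq0 f : dual_norm f = 0 -> f = 0.
Proof.
move=> f0; apply: dualP => x; apply/eqP; rewrite -normr_le0.
by rewrite (le_trans (ler_dual_norm f x))// f0 mul0r.
Qed.

HB.instance Definition _ := Lmodule_isNormed.Build R (dual X)
  dual_normD dual_normZ dual_norm0_eq0.

Lemma dual_normE f : `|f| = dual_norm f. Proof. by []. Qed.

Lemma ler_dual f x : `|f x : R| <= `|f| * `|x|.
Proof. exact: ler_dual_norm. Qed.

Fact dual_complete (F : set_system (dual X)) :
  ProperFilter F -> cauchy F -> cvg F.
Proof.
move=> FF /cauchy_ballP Fc.
have Fnear e : 0 < e -> \forall f & g \near F, `|f - g| < e.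
  by move=> /Fc; apply: filterS => -[f g] /=; rewrite -ball_normE.
have Fpt x : cvg ((fun f : dual X => f x : R^o) @ F).
  apply: cauchy_cvg; apply/cauchy_ballP => e e0.
  have d0 : 0 < e / (`|x| + 1) by rewrite divr_gt0 ?ltr_wpDl.
  have [[A B] [/= FA FB] AB] := Fnear _ d0.
  exists ((fun f : dual X => f x : R^o) @` A, (fun f : dual X => f x : R^o) @` B).
    by split; rewrite /= nbhs_simpl; [apply: filterS FA|apply: filterS FB];
      move=> f; exists f.
  move=> [_ _] [/= [f Af <-] [g Bg <-]].
  rewrite -ball_normE /ball_ /= -dualN -dualD.
  rewrite (le_lt_trans (ler_dual_norm _ _))//.
  have := AB (f, g) (conj Af Bg); rewrite /= dual_normE.
  rewrite ltr_pdivlMr ?ltr_wpDl//; apply: le_lt_trans.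
  by rewrite ler_wpM2l ?dual_norm_ge0// lerDl.
pose L x : R^o := lim ((fun f : dual X => f x : R^o) @ F).
have Lcvg x : (fun f : dual X => f x : R^o) @ F --> L x by exact: Fpt.
have linL : linear L.
  move=> a x y; apply: cvg_lim; first exact: norm_hausdorff.
  have -> : (fun f : dual X => f (a *: x + y) : R^o) =
            (fun f => a *: (f x : R^o) + f y).
    by apply/funext => f; rewrite linearP.
  by apply: cvgD; [apply: cvgZr; exact: Lcvg|exact: Lcvg].
have close e : 0 < e -> \forall f \near F, forall x, `|(f : dual X) x - L x| <= e * `|x|.
  move=> e0; have [[A B] [/= FA FB] AB] := Fnear _ e0.
  near=> f => z; rewrite distrC.
  have cf : (fun g : dual X => `|g z - f z| : R^o) @ F --> (`|L z - f z| : R^o).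
    by apply: cvg_norm; apply: cvgB; [exact: Lcvg|exact: cvg_cst].
  rewrite -(cvg_lim _ cf)//.
  apply: limr_le; first by apply/cvg_ex; eexists; exact: cf.
  near=> g; rewrite distrC -dualN -dualD (le_trans (ler_dual_norm _ _))//.
  rewrite ler_wpM2r// -dual_normE ltW//.
  have Af : A f by near: f.
  have Bg : B g by near: g.
  exact: (AB (f, g)).
have bL : L \in bounded_functional X.
  apply/bounded_functionalP; split => //.
  have [f fL] := filter_ex (close 1 ltr01).
  exists (dual_norm f + 1) => [|x]; first by rewrite addr_ge0 ?dual_norm_ge0.
  rewrite -[L x](subrK (f x)) addrC (le_trans (ler_normD _ _))//.
  by rewrite mulrDl lerD ?ler_dual_norm// distrC.
apply/cvg_ex; exists (Dual bL); apply/cvgrPdist_le => e e0.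
apply: filterS (close e e0) => f fL; rewrite distrC dual_normE.
by apply: dual_norm_le => [|x]; [exact: ltW|exact: fL].
Unshelve. all: by end_near. Qed.

HB.instance Definition _ := Uniform_isComplete.Build (dual X) dual_complete.

End DualNormed.

(* [Order.Lattice] cannot be used here: a structure joining it with normed
   modules would have to be declared before [Num.RealDomain], so the order and
   the lattice operations are fields of the mixin. The field [vle_norm] says
   that [|x| <= |y|] implies [`|x| <= `|y|], where [|x|] is the modulus [vabs]
   below and [`|x|] the norm. *)
HB.mixin Record isBanachLattice (R : realType) E
    & CompleteNormedModule R E := {
  vle : E -> E -> Prop;
  vjoin : E -> E -> E;
  vmeet : E -> E -> E;
  vle_refl : forall x, vle x x;
  vle_anti : forall x y, vle x y -> vle y x -> x = y;
  vle_trans : forall y x z, vle x y -> vle y z -> vle x z;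
  vjoinP : forall x y z, vle (vjoin x y) z <-> vle x z /\ vle y z;
  vmeetP : forall x y z, vle z (vmeet x y) <-> vle z x /\ vle z y;
  vleD2r : forall x y z, vle x y -> vle (x + z) (y + z);
  vleZ : forall (a : R) x, 0 <= a -> vle 0 x -> vle 0 (a *: x);
  vle_norm : forall x y,
    vle (vjoin x (- x)) (vjoin y (- y)) -> `|x| <= `|y| }.

#[short(type="banachLatticeType")]
HB.structure Definition BanachLattice (R : realType) :=
  {E of CompleteNormedModule R E & isBanachLattice R E}.

Notation "x <=v y" := (vle x y) (at level 70, no associativity).

Definition vabs (R : realType) (E : banachLatticeType R) (x : E) : E :=
  vjoin x (- x).

Section BanachLatticeTheory.
Variables (R : realType) (E : banachLatticeType R).
Implicit Types x y z : E.

Lemma vjoinl x y : x <=v vjoin x y.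
Proof. by have /vjoinP[] := vle_refl (vjoin x y). Qed.
Lemma vjoinr x y : y <=v vjoin x y.
Proof. by have /vjoinP[] := vle_refl (vjoin x y). Qed.
Lemma vmeetl x y : vmeet x y <=v x.
Proof. by have /vmeetP[] := vle_refl (vmeet x y). Qed.
Lemma vmeetr x y : vmeet x y <=v y.
Proof. by have /vmeetP[] := vle_refl (vmeet x y). Qed.

Lemma vsub_ge0 x y : 0 <=v y - x <-> x <=v y.
Proof.
split=> [/(vleD2r _ _ x)|/(vleD2r _ _ (- x))]; first by rewrite add0r subrK.
by rewrite subrr.
Qed.

Lemma vleN2 x y : x <=v y -> - y <=v - x.
Proof. by move=> /vsub_ge0 xy; apply/vsub_ge0; rewrite opprK addrC. Qed.

Lemma vaddr_ge0 x y : 0 <=v x -> 0 <=v y -> 0 <=v x + y.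
Proof.
by move=> x0 y0; apply: vle_trans y0 _; apply/vsub_ge0; rewrite addrK.
Qed.

Lemma vabs_ge0 x : 0 <=v vabs x.
Proof.
have : 0 <=v vabs x + vabs x.
  by rewrite -{1}(subrr x); apply: (@vle_trans _ _ (vabs x - x));
    [apply: vleD2r; exact: vjoinl|rewrite ![vabs x + _]addrC; apply: vleD2r;
      exact: vjoinr].
have h2 : 0 <= 2^-1 :> R by rewrite invr_ge0 ler0n.
move=> /(vleZ 2^-1 _ h2).
by rewrite -[vabs x + _]mulr2n -[vabs x *+ _]scaler_nat scalerA mulVf ?pnatr_eq0// scale1r.
Qed.

Lemma vabs_le x y : x <=v y -> - x <=v y -> vabs x <=v y.
Proof. by move=> xy nxy; apply/vjoinP. Qed.

Lemma vle_norm2 x y : x <=v y -> - x <=v y -> `|x| <= `|y|.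
Proof.
move=> xy nxy; apply: vle_norm; apply: (@vle_trans _ _ y); first exact/vjoinP.
exact: vjoinl.
Qed.

Lemma vle_norm_ge0 x y : 0 <=v x -> x <=v y -> `|x| <= `|y|.
Proof.
move=> x0 xy; apply: vle_norm2 => //; apply: vle_trans (_ : _ <=v 0) _.
  by rewrite -oppr0; exact: vleN2.
exact: vle_trans xy.
Qed.

Lemma norm_vabs_le x : `|vabs x| <= `|x|.
Proof.
apply: vle_norm; apply/vjoinP; split; first exact: vle_refl.
apply: vle_trans (vabs_ge0 x); rewrite -oppr0; exact: vleN2 (vabs_ge0 x).
Qed.

Lemma vriesz x y z : 0 <=v x -> 0 <=v y -> 0 <=v z -> z <=v x + y ->
  exists a b, [/\ 0 <=v a /\ a <=v x, 0 <=v b /\ b <=v y & z = a + b].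
Proof.
move=> x0 y0 z0 zxy; exists (vmeet z x), (z - vmeet z x).
split; last by rewrite addrC subrK.
  by split; [exact/vmeetP|exact: vmeetr].
split; first by apply/vsub_ge0; exact: vmeetl.
have zy : z - y <=v vmeet z x.
  apply/vmeetP; split; apply/vsub_ge0; first by rewrite opprB addrC subrK.
  by rewrite opprB addrA; apply/vsub_ge0.
have := vleD2r _ _ (y - vmeet z x) zy.
by rewrite addrA subrK [vmeet z x + _]addrC subrK.
Qed.

End BanachLatticeTheory.

Section DualLattice.
Variables (R : realType) (E : banachLatticeType R).
Implicit Types (x y z : E) (f g h : dual E).

Definition dual_le f g : Prop := forall x, 0 <=v x -> f x <= g x.

(* Riesz-Kantorovich formula for the join of [f] and [g] at [x >= 0]; it is
   extended to all [x] through [x = x^+ - (x^+ - x)]. *)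
Definition dual_join_pos f g x : R :=
  sup [set (f y + g (x - y) : R) | y in [set y | 0 <=v y /\ y <=v x]].

Definition dual_join_fun f g x : R^o :=
  dual_join_pos f g (vjoin x 0) - dual_join_pos f g (vjoin x 0 - x).

Lemma dual_join_pos_bound f g x y : 0 <=v y -> y <=v x ->
  f y + g (x - y) <= (`|f| + `|g|) * `|x|.
Proof.
move=> y0 yx; rewrite (le_trans (ler_norm _))// (le_trans (ler_normD _ _))//.
rewrite mulrDl lerD//; rewrite (le_trans (ler_dual _ _))//.
  by rewrite ler_wpM2l//; exact: vle_norm_ge0.
rewrite ler_wpM2l//; apply: vle_norm_ge0; first exact/vsub_ge0.
by apply/vsub_ge0; rewrite opprB addrC subrK.
Qed.

Lemma dual_join_pos_has_sup f g x : 0 <=v x ->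
  has_sup [set (f y + g (x - y) : R) | y in [set y | 0 <=v y /\ y <=v x]].
Proof.
move=> x0; split.
  by exists (f x + g (x - x)), x => //; split => //; exact: vle_refl.
by exists ((`|f| + `|g|) * `|x|) => _ [y [y0 yx] <-]; exact: dual_join_pos_bound.
Qed.

Lemma dual_join_pos_ub f g x y : 0 <=v y -> y <=v x ->
  f y + g (x - y) <= dual_join_pos f g x.
Proof.
move=> y0 yx; apply: ub_le_sup; last by exists y.
by case: (dual_join_pos_has_sup f g (vle_trans _ _ _ y0 yx)).
Qed.

Lemma dual_join_pos_le f g x (M : R) : 0 <=v x ->
  (forall y, 0 <=v y -> y <=v x -> f y + g (x - y) <= M) ->
  dual_join_pos f g x <= M.
Proof.
move=> x0 xM; apply: ge_sup; first by case: (dual_join_pos_has_sup f g x0).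
by move=> _ [y [y0 yx] <-]; exact: xM.
Qed.

Lemma dual_join_posD f g x y : 0 <=v x -> 0 <=v y ->
  dual_join_pos f g (x + y) = dual_join_pos f g x + dual_join_pos f g y.
Proof.
move=> x0 y0; apply/eqP; rewrite eq_le; apply/andP; split.
  apply: dual_join_pos_le => [|z z0 zxy]; first exact: vaddr_ge0.
  have [a [b [[a0 ax] [b0 bY] ->]]] := vriesz x0 y0 z0 zxy.
  rewrite opprD addrACA !linearD /= addrACA.
  by rewrite -!linearD/= lerD//; exact: dual_join_pos_ub.
rewrite -lerBrDr; apply: dual_join_pos_le => // a a0 ax.
rewrite lerBrDr addrC -lerBrDr; apply: dual_join_pos_le => // b b0 bY.
rewrite lerBrDr addrACA -!linearD /= -opprB -opprB opprK.
have -> : y - b + (x - a) = x + y - (b + a).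
  by rewrite addrACA [y + x]addrC -opprD.
apply: dual_join_pos_ub; first exact: vaddr_ge0.
apply/vsub_ge0; rewrite [b + a]addrC opprD addrACA.
by apply: vaddr_ge0; exact/vsub_ge0.
Qed.

Lemma dual_join_pos0 f g : dual_join_pos f g 0 = 0.
Proof.
have := @dual_join_posD f g 0 0 (vle_refl _) (vle_refl _).
by rewrite addr0 => /esym/eqP; rewrite -subr_eq0 addrK => /eqP.
Qed.

Lemma dual_join_posZ f g a x : 0 <= a -> 0 <=v x ->
  dual_join_pos f g (a *: x) = a * dual_join_pos f g x.
Proof.
move=> a0 x0; have [->|an0] := eqVneq a 0.
  by rewrite scale0r mul0r dual_join_pos0.
have le b y : 0 < b -> 0 <=v y ->
    dual_join_pos f g (b *: y) <= b * dual_join_pos f g y.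
  move=> b0 y0; apply: dual_join_pos_le => [|z z0 zy].
    by apply: vleZ => //; exact: ltW.
  have bi0 : 0 <= b^-1 by rewrite invr_ge0 ltW.
  rewrite -ler_pdivrMl// mulrDr.
  have -> : b^-1 * f z + b^-1 * g (b *: y - z) =
      f (b^-1 *: z) + g (y - b^-1 *: z).
    rewrite -[X in _ = _ + g (X - _)](scalerK (lt0r_neq0 b0)) -scalerBr.
    by rewrite !linearZ.
  apply: dual_join_pos_ub; first exact: vleZ.
  apply/vsub_ge0; rewrite -[X in X - _](scalerK (lt0r_neq0 b0)) -scalerBr.
  by apply: vleZ => //; exact/vsub_ge0.
have a1 : 0 < a by rewrite lt0r an0.
apply/eqP; rewrite eq_le le//= -ler_pdivlMl//.
rewrite -{1}[x](scalerK an0) le ?invr_gt0//; exact: vleZ.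
Qed.

Lemma vpos_ge0 x : 0 <=v vjoin x 0. Proof. exact: vjoinr. Qed.
Lemma vneg_ge0 x : 0 <=v vjoin x 0 - x.
Proof. by apply/vsub_ge0; exact: vjoinl. Qed.

Lemma dual_join_funB f g x y : 0 <=v x -> 0 <=v y ->
  dual_join_fun f g (x - y) = dual_join_pos f g x - dual_join_pos f g y.
Proof.
move=> x0 y0; rewrite /dual_join_fun; set p := vjoin _ _.
have p0 : 0 <=v p := vpos_ge0 _.
have n0 : 0 <=v p - (x - y) := vneg_ge0 _.
apply/eqP; rewrite subr_eq addrAC eq_sym subr_eq; apply/eqP.
by rewrite -!dual_join_posD// opprB addrCA subrKC addrC.
Qed.

Lemma dual_join_fun_ge0 f g x : 0 <=v x ->
  dual_join_fun f g x = dual_join_pos f g x.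
Proof.
move=> x0; rewrite -[x in LHS]subr0 dual_join_funB//; last exact: vle_refl.
by rewrite dual_join_pos0 subr0.
Qed.

Lemma dual_join_pos_norm f g x : 0 <=v x ->
  `|dual_join_pos f g x| <= (`|f| + `|g|) * `|x|.
Proof.
move=> x0; rewrite ler_norml; apply/andP; split; last first.
  by apply: dual_join_pos_le => // y; exact: dual_join_pos_bound.
apply: le_trans (dual_join_pos_ub f g x0 (vle_refl _)).
rewrite subrr linear0 addr0 lerNl -dualN (le_trans (ler_norm _))//.
rewrite dualN normrN (le_trans (ler_dual _ _))// ler_wpM2r//.
by rewrite lerDl.
Qed.

Fact dual_join_subproof f g : dual_join_fun f g \in bounded_functional E.
Proof.
apply/bounded_functionalP; split=> [a x y|].
  have xE := subKr (vjoin x 0) x; have yE := subKr (vjoin y 0) y.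
  rewrite -{1}xE -{1}yE.
  set xp := vjoin x 0; set xn := xp - x; set yp := vjoin y 0; set yn := yp - y.
  have xp0 : 0 <=v xp := vpos_ge0 x. have xn0 : 0 <=v xn := vneg_ge0 x.
  have yp0 : 0 <=v yp := vpos_ge0 y. have yn0 : 0 <=v yn := vneg_ge0 y.
  have JE : a *: dual_join_fun f g x + dual_join_fun f g y =
      a * (dual_join_pos f g xp - dual_join_pos f g xn) +
      (dual_join_pos f g yp - dual_join_pos f g yn) by [].
  rewrite {}JE; clear xE yE; clearbody xn yn; clearbody xp yp.
  have [a0|a0] := leP 0 a.
    have -> : a *: (xp - xn) + (yp - yn) = (a *: xp + yp) - (a *: xn + yn).
      by rewrite scalerBr opprD addrACA.
    have Zp := vleZ a _ a0 xp0; have Zn := vleZ a _ a0 xn0.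
    rewrite dual_join_funB; [|exact: vaddr_ge0..].
    by rewrite !dual_join_posD// !dual_join_posZ// opprD addrACA mulrBr.
  have na0 : 0 <= - a by rewrite oppr_ge0 ltW.
  have -> : a *: (xp - xn) + (yp - yn) = (- a *: xn + yp) - (- a *: xp + yn).
    by rewrite !scaleNr opprD opprK addrACA scalerBr [- _ + a *: xp]addrC.
  have Zp := vleZ _ _ na0 xp0; have Zn := vleZ _ _ na0 xn0.
  rewrite dual_join_funB; [|exact: vaddr_ge0..].
  by rewrite !dual_join_posD// !dual_join_posZ// !mulNr opprD opprK addrACA mulrBr [- _ + a * _]addrC.
have fg0 : 0 <= `|f| + `|g| by rewrite addr_ge0.
exists ((`|f| + `|g|) * 3) => [|x]; first by rewrite mulr_ge0.
have px : `|vjoin x 0| <= `|x|.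
  rewrite (le_trans _ (norm_vabs_le x))//; apply: vle_norm_ge0 (vpos_ge0 x) _.
  by apply/vjoinP; split; [exact: vjoinl|exact: vabs_ge0].
rewrite (le_trans (ler_normB _ _))//.
rewrite (le_trans (lerD (dual_join_pos_norm f g (vpos_ge0 x))
  (dual_join_pos_norm f g (vneg_ge0 x))))//.
rewrite -mulrDr -mulrA ler_wpM2l//.
rewrite (le_trans (lerD px (ler_normB _ _)))// (le_trans (lerD (lexx _) (lerD px (lexx _))))//.
by rewrite -mulr2n -mulrS mulr_natl.
Qed.

Definition dual_join f g : dual E := Dual (dual_join_subproof f g).
Definition dual_meet f g : dual E := - dual_join (- f) (- g).

Lemma dual_joinE f g x : 0 <=v x -> dual_join f g x = dual_join_pos f g x.
Proof. exact: dual_join_fun_ge0. Qed.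

Fact dual_le_refl f : dual_le f f. Proof. by move=> x _. Qed.

Fact dual_le_anti f g : dual_le f g -> dual_le g f -> f = g.
Proof.
move=> fg gf; have pos x : 0 <=v x -> f x = g x.
  by move=> x0; apply/eqP; rewrite eq_le fg//= gf.
have posB x y : 0 <=v x -> 0 <=v y -> f (x - y) = g (x - y).
  by move=> x0 y0; rewrite !linearB /= !pos.
apply: dualP => x; rewrite -(subKr (vjoin x 0) x).
by apply: posB; [exact: vpos_ge0|exact: vneg_ge0].
Qed.

Fact dual_le_trans g f h : dual_le f g -> dual_le g h -> dual_le f h.
Proof. by move=> fg gh x x0; rewrite (le_trans (fg x x0))// gh. Qed.

Fact dual_joinP f g h : dual_le (dual_join f g) h <-> dual_le f h /\ dual_le g h.
Proof.
split=> [J|[fh gh] x x0].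
  split=> x x0; rewrite (le_trans _ (J x x0))// dual_joinE//.
    by have := dual_join_pos_ub f g x0 (vle_refl _); rewrite subrr linear0 addr0.
  have := dual_join_pos_ub f g (vle_refl _) x0.
  by rewrite subr0 linear0 add0r.
rewrite dual_joinE//; apply: dual_join_pos_le => // y y0 yx.
have -> : h x = h y + h (x - y) by rewrite -linearD /= subrKC.
by rewrite lerD ?fh ?gh//; exact/vsub_ge0.
Qed.

Fact dual_meetP f g h : dual_le h (dual_meet f g) <-> dual_le h f /\ dual_le h g.
Proof.
have leN (k l : dual E) : dual_le k l <-> dual_le (- l) (- k).
  by split=> kl x /kl; rewrite ?dualN lerN2.
by rewrite leN /dual_meet opprK dual_joinP (leN h f) (leN h g).
Qed.

Fact dual_leD2r f g h : dual_le f g -> dual_le (f + h) (g + h).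
Proof. by move=> fg x x0; rewrite !dualD lerD2r fg. Qed.

Fact dual_leZ (a : R) f : 0 <= a -> dual_le 0 f -> dual_le 0 (a *: f).
Proof. by move=> a0 f0 x x0; rewrite dual0 dualZ mulr_ge0//; exact: f0. Qed.

Lemma dual_abs_ub f x : f x <= dual_join f (- f) (vabs x).
Proof.
rewrite dual_joinE; last exact: vabs_ge0.
pose y := 2^-1 *: (vabs x + x).
have h2 : 0 <= 2^-1 :> R by rewrite invr_ge0.
have half z : 2^-1 *: (z + z) = z.
  by rewrite -[z + z]mulr2n -[z *+ _]scaler_nat scalerA mulVf ?pnatr_eq0// scale1r.
have yE : vabs x - y = 2^-1 *: (vabs x - x).
  by rewrite /y -{1}(half (vabs x)) -scalerBr opprD addrACA subrr add0r.
have y0 : 0 <=v y.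
  apply: vleZ => //; have -> : vabs x + x = vabs x - - x by rewrite opprK.
  by apply/vsub_ge0; exact: vjoinr.
have yx : y <=v vabs x.
  apply/vsub_ge0; rewrite yE; apply: vleZ => //.
  by apply/vsub_ge0; exact: vjoinl.
have xE : y - (vabs x - y) = x.
  by rewrite yE /y -scalerBr opprB addrC addrA subrK half.
have := dual_join_pos_ub f (- f) y0 yx; apply: le_trans.
by rewrite dualN -linearB /= xE.
Qed.

Fact dual_le_norm f g :
  dual_le (dual_join f (- f)) (dual_join g (- g)) -> `|f| <= `|g|.
Proof.
move=> fg; have key x : f x <= `|g| * `|x|.
  rewrite (le_trans (dual_abs_ub f x))// (le_trans (fg _ (vabs_ge0 x)))//.
  rewrite dual_joinE; last exact: vabs_ge0.
  apply: dual_join_pos_le => [|y y0 yx]; first exact: vabs_ge0.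
  rewrite dualN -linearB /= opprB (le_trans (ler_norm _))//.
  rewrite (le_trans (ler_dual _ _))// ler_wpM2l//.
  rewrite (le_trans _ (norm_vabs_le x))//; apply: vle_norm2.
    apply/vsub_ge0; rewrite opprD opprB addrA.
    by apply: vaddr_ge0; exact/vsub_ge0.
  apply/vsub_ge0; rewrite opprK addrCA subrKC.
  exact: vaddr_ge0.
rewrite dual_normE; apply: dual_norm_le => // x; rewrite ler_norml key andbT.
by rewrite lerNl -linearN /= -(normrN x) key.
Qed.

HB.instance Definition _ := isBanachLattice.Build R (dual E)
  dual_le_refl dual_le_anti dual_le_trans dual_joinP dual_meetP
  dual_leD2r dual_leZ dual_le_norm.

End DualLattice.

Section Definitions.
Variable R : realType.

Definition weakly_null (X : normedModType R) (x : nat -> X) : Prop :=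
  forall f : dual X, f (x n) @[n --> \oo] --> (0 : R).

Definition wstar_null (X : normedModType R) (f : nat -> dual X) : Prop :=
  forall x : X, f n x @[n --> \oo] --> (0 : R).

Definition limited_set (X : normedModType R) (C : set X) : Prop :=
  bounded_set C /\
  forall f : nat -> dual X, wstar_null f ->
    {uniform C, (f n : X -> R^o) @[n --> \oo] --> (cst 0 : X -> R^o)}.

Definition limited_operator (X Y : normedModType R) (T : X -> Y) : Prop :=
  limited_set (T @` unit_ball X).

Definition disjoint_seq (E : banachLatticeType R) (x : nat -> E) : Prop :=
  forall n m : nat, n != m -> vmeet (vabs (x n)) (vabs (x m)) = 0.

Definition positive_operator (E F : banachLatticeType R) (T : E -> F) : Prop :=
  forall x : E, 0 <=v x -> 0 <=v T x.

Definition almost_Dunford_Pettis (E : banachLatticeType R)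
    (Y : normedModType R) (T : E -> Y) : Prop :=
  forall x : nat -> E, disjoint_seq x -> weakly_null x ->
    `|T (x n)| @[n --> \oo] --> (0 : R).

Definition M_weakly_compact (E : banachLatticeType R)
    (Y : normedModType R) (T : E -> Y) : Prop :=
  forall x : nat -> E, disjoint_seq x -> bounded_set (range x) ->
    `|T (x n)| @[n --> \oo] --> (0 : R).

Definition KB_space (E : banachLatticeType R) : Prop :=
  forall u : nat -> E, (forall n, 0 <=v u n) -> (forall n, u n <=v u n.+1) ->
    bounded_set (range u) -> cvg (u @ \oo).

(* The modulus [vabs] is taken in the Banach lattice [dual E]. *)
Definition wstar_seq_continuous_lattice_ops (E : banachLatticeType R) : Prop :=
  forall f : nat -> dual E, wstar_null f -> wstar_null (fun n => vabs (f n)).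

End Definitions.

(* Main.v *)
Require Import Defs.
From mathcomp Require Import all_boot all_order all_algebra.
From mathcomp Require Import boolp classical_sets functions reals topology.
From mathcomp Require Import normedtype sequences.
From mathcomp Require Import lra.

(* For a weak*-null sequence [f n], the operator [T] is limited as soon as
   [f n \o T --> 0] in norm. In both cases [|f n \o T| --> 0] weak*, since
   [|f n \o T| <= |f n| \o T] for [T >= 0], and [T] is M-weakly compact, since
   disjoint bounded sequences are weakly null when [E^*] is a KB-space. Were
   [|f n \o T|] bounded below, a sliding hump would give a disjoint bounded
   sequence [y k] and indices [n k] with [f (n k) (T (y k))] bounded below,
   against [T (y k) --> 0] and the uniform boundedness of [f n]. *)

Set Implicit Arguments.
Unset Strict Implicit.
Unset Printing Implicit Defensive.

Import Order.TTheory GRing.Theory Num.Theory.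
Import numFieldNormedType.Exports.

Local Open Scope classical_set_scope.
Local Open Scope ring_scope.

(** * Order estimates, positive parts and disjointness in a Banach lattice *)

Section VectorLattice.
Context {R : realType} {E : banachLatticeType R}.
Implicit Types x y z : E.

Lemma vleD x y z t : x <=v y -> z <=v t -> x + z <=v y + t.
Proof.
move=> xy zt; apply: (@vle_trans _ _ (y + z)); first exact: vleD2r.
by rewrite ![y + _]addrC; exact: vleD2r.
Qed.

Lemma vler_addl x y : 0 <=v y -> x <=v x + y.
Proof. by move=> y0; apply/vsub_ge0; rewrite addrAC subrr add0r. Qed.

Lemma vler_subl x y : 0 <=v y -> x - y <=v x.
Proof. by move=> y0; apply/vsub_ge0; rewrite opprB addrCA subrr addr0. Qed.

Lemma ler_vZ (a : R) x y : 0 <= a -> x <=v y -> a *: x <=v a *: y.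
Proof.
move=> a0 xy; apply/vsub_ge0; rewrite -scalerBr; apply: vleZ => //.
exact/vsub_ge0.
Qed.

Lemma ler_vZl (a b : R) x : 0 <=v x -> a <= b -> a *: x <=v b *: x.
Proof.
by move=> x0 ab; apply/vsub_ge0; rewrite -scalerBl; apply: vleZ; rewrite ?subr_ge0.
Qed.

Lemma vpos_le x y : x <=v y -> 0 <=v y -> vjoin x 0 <=v y.
Proof. by move=> *; apply/vjoinP. Qed.

Lemma vpos_mono x y : x <=v y -> vjoin x 0 <=v vjoin y 0.
Proof.
move=> xy; apply: vpos_le; last exact: vjoinr.
exact: vle_trans xy (vjoinl _ _).
Qed.

Lemma vabs_id x : 0 <=v x -> vabs x = x.
Proof.
move=> x0; apply: vle_anti (vjoinl _ _); apply: vabs_le; first exact: vle_refl.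
by apply: vle_trans (x0); rewrite -oppr0; exact: vleN2.
Qed.

Lemma norm_vabs x : `|vabs x| = `|x|.
Proof.
apply/le_anti; rewrite norm_vabs_le /=; apply: vle_norm2; first exact: vjoinl.
exact: vjoinr.
Qed.

Lemma vmeet_ge0 x y : 0 <=v x -> 0 <=v y -> 0 <=v vmeet x y.
Proof. by move=> *; apply/vmeetP. Qed.

Lemma vmeetC x y : vmeet x y = vmeet y x.
Proof.
by apply: vle_anti; apply/vmeetP; split; by [exact: vmeetl|exact: vmeetr].
Qed.

Lemma vmeet_mono x y z t : x <=v z -> y <=v t -> vmeet x y <=v vmeet z t.
Proof.
move=> xz yt; apply/vmeetP; split; first exact: vle_trans (vmeetl _ _) xz.
exact: vle_trans (vmeetr _ _) yt.
Qed.

Lemma vmeet_eq0 x y z t : 0 <=v x -> 0 <=v y -> x <=v z -> y <=v t ->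
  vmeet z t = 0 -> vmeet x y = 0.
Proof.
move=> x0 y0 xz yt zt; apply: vle_anti (vmeet_ge0 x0 y0).
by rewrite -zt; exact: vmeet_mono.
Qed.

(** Riesz decomposition writes the left side as [a + b] with [0 <= a <= y] and [0 <= b <= z]; each
    summand lies below [a + b], hence below [x]. *)
Lemma vmeetDr x y z : 0 <=v x -> 0 <=v y -> 0 <=v z ->
  vmeet x (y + z) <=v vmeet x y + vmeet x z.
Proof.
move=> x0 y0 z0.
have w0 : 0 <=v vmeet x (y + z) by apply: vmeet_ge0 => //; exact: vaddr_ge0.
have [a [b [[a0 ay] [b0 bz] wE]]] := vriesz y0 z0 w0 (vmeetr _ _).
have wx := vmeetl x (y + z); rewrite wE in wx *.
apply: vleD; apply/vmeetP; split=> //; apply: vle_trans wx.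
  exact: vler_addl.
by rewrite addrC; exact: vler_addl.
Qed.

Lemma vmeetD_eq0 x y z : 0 <=v x -> 0 <=v y -> 0 <=v z ->
  vmeet x y = 0 -> vmeet x z = 0 -> vmeet x (y + z) = 0.
Proof.
move=> x0 y0 z0 xy xz; apply: vle_anti.
  by rewrite -[X in vle _ X]addr0 -{1}xy -xz; exact: vmeetDr.
by apply: vmeet_ge0 => //; exact: vaddr_ge0.
Qed.

Lemma vmeetZ_eq0 (c : R) x y : 0 <= c -> 0 <=v x -> 0 <=v y ->
  vmeet x y = 0 -> vmeet x (c *: y) = 0.
Proof.
(* The factor [c + 1] is at least [1] and at least [c], so [x] and [c *: y] lie below [c + 1] times
   [x] and [y], and their meet lies below [(c + 1) *: vmeet x y]. *)
move=> c0 x0 y0 xy; have c1 : 0 < c + 1 by rewrite ltr_wpDl.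
have le1 z : 0 <=v z -> z <=v (c + 1) *: z.
  by move=> z0; rewrite -{1}[z]scale1r; apply: ler_vZl => //; rewrite lerDr.
have d0 : 0 <=v vmeet x (c *: y) by apply: vmeet_ge0 => //; exact: vleZ.
apply: vle_anti d0; set d := vmeet _ _.
have : d <=v (c + 1) *: vmeet x y; last by rewrite xy scaler0.
have ci0 : 0 <= (c + 1)^-1 by rewrite invr_ge0 ltW.
rewrite -[X in vle X _](scalerKV (lt0r_neq0 c1)).
apply: ler_vZ; first exact: ltW.
apply/vmeetP; split; rewrite -[X in vle _ X](scalerK (lt0r_neq0 c1));
  apply: ler_vZ => //.
  by apply: vle_trans (vmeetl _ _) _; exact: le1.
by apply: vle_trans (vmeetr _ _) _; apply: ler_vZl => //; rewrite lerDl.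
Qed.

(** For [d] the meet of the two parts, [n <= p - x] gives [x <= p - d]; as also [0 <= p - d],
    minimality of [p] forces [p <= p - d]. *)
Lemma vpos_disj x : vmeet (vjoin x 0) (vjoin (- x) 0) = 0.
Proof.
set p := vjoin x 0; set n := vjoin (- x) 0.
have np : n <=v p - x.
  apply: vpos_le; last exact: vneg_ge0.
  rewrite -[X in vle X _]add0r; apply: vleD2r; exact: vjoinr.
apply: vle_anti (vmeet_ge0 (vjoinr _ _) (vjoinr _ _)).
set d := vmeet p n.
have : p <=v p - d.
  apply: vpos_le; apply/vsub_ge0.
    rewrite addrAC; apply/vsub_ge0; exact: vle_trans (vmeetr _ _) np.
  exact: vmeetl.
move=> /(vleD2r _ _ (d - p)).
by rewrite addrC subrK addrC addrA subrK subrr.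
Qed.

(** The vector [y - c^-1 *: x] is a positive multiple of the opposite of [x - c *: y], so up to
    scaling these are the two parts of one vector. *)
Lemma vpos_scaled_disj (c : R) x y : 0 < c ->
  vmeet (vjoin (x - c *: y) 0) (vjoin (y - c^-1 *: x) 0) = 0.
Proof.
move=> c0; apply: (@vmeet_eq0 _ _ (vjoin (x - c *: y) 0)
    (c^-1 *: vjoin (- (x - c *: y)) 0)); [exact: vjoinr|exact: vjoinr| | |].
- exact: vle_refl.
- apply: vpos_le; last by apply: vleZ; [rewrite invr_ge0 ltW|exact: vjoinr].
  have -> : y - c^-1 *: x = c^-1 *: (- (x - c *: y)).
    by rewrite opprB scalerBr scalerK// lt0r_neq0.
  by apply: ler_vZ; [rewrite invr_ge0 ltW|exact: vjoinl].
- apply: vmeetZ_eq0; [by rewrite invr_ge0 ltW|exact: vjoinr|exact: vjoinr|].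
  exact: vpos_disj.
Qed.

(** Once [0 <= u n], the negative part of [l] lies below [|u n - l|], whose norm tends to [0]. *)
Lemma vcone_closed (u : nat -> E) l :
  u n @[n --> \oo] --> l -> (\forall n \near \oo, 0 <=v u n) -> 0 <=v l.
Proof.
move=> ul u0; suff n0 : vjoin (- l) 0 = 0.
  by rewrite -[l]opprK -oppr0; apply: vleN2; rewrite -[X in vle _ X]n0; exact: vjoinl.
apply/eqP; rewrite -normr_le0; apply/ler_addgt0Pr => e e0; rewrite add0r.
have /cvgrPdist_lt/(_ e e0) close := ul.
have [n [un ln]] := filter_ex (filterI u0 close).
apply: le_trans (ltW ln); rewrite distrC -(norm_vabs (_ - _)).
apply: vle_norm_ge0; first exact: vjoinr.
apply: vpos_le; last exact: vabs_ge0.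
by apply: vle_trans (vjoinl _ _); rewrite addrC; exact: vler_addl.
Qed.

End VectorLattice.

(** * The modulus of a functional and its components *)

Section OrderDual.
Context {R : realType} {E : banachLatticeType R}.
Implicit Types (x y z : E) (f g : dual E).

Lemma dual_ge0 f x : 0 <=v f -> 0 <=v x -> 0 <= f x.
Proof. by move=> f0 x0; exact: (f0 x x0). Qed.

Lemma dual_mono f x y : 0 <=v f -> x <=v y -> f x <= f y.
Proof.
by move=> f0 /vsub_ge0 xy; rewrite -subr_ge0 -linearB; exact: dual_ge0.
Qed.

Lemma dual_vabs f x : `|f x| <= vabs f (vabs x).
Proof.
rewrite ler_norml lerNl; apply/andP; split; last exact: dual_abs_ub.
rewrite -linearN; have -> : vabs x = vabs (- x).
  apply: vle_anti; rewrite /vabs opprK; apply/vjoinP;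
    by split; [exact: vjoinr|exact: vjoinl].
exact: dual_abs_ub.
Qed.

Lemma vabs_dual_approx f x (e : R) : 0 < e -> 0 <=v x ->
  exists2 y, vabs y <=v x & vabs f x - e < f y.
Proof.
move=> e0 x0; have -> : vabs f x = dual_join_pos f (- f) x :> R.
  exact: dual_joinE.
have [_ [y [y0 yx] <-]] := sup_adherent e0 (dual_join_pos_has_sup f (- f) x0).
rewrite -/(dual_join_pos f (- f) x) dualN => h.
(* Here [y] nearly attains the Riesz-Kantorovich supremum of [f y - f (x - y)], and [0 <= y <= x]
   puts [y - (x - y)] between [- x] and [x]. *)
exists (y - (x - y)); last by rewrite linearB.
apply: vabs_le; apply/vsub_ge0.
  by rewrite opprB addrCA; apply: vaddr_ge0; exact/vsub_ge0.
by rewrite opprK opprB addrCA subrKC; exact: vaddr_ge0.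
Qed.

(** The extension is by differences of positive vectors. It is bounded because [y = |y| - (|y| - y)]
    gives [q y <= p |y| <= f |y|]. *)
Lemma dual_extend (p : E -> R) f :
  (forall x y, 0 <=v x -> 0 <=v y -> p (x + y) = p x + p y) ->
  (forall a x, 0 <= a -> 0 <=v x -> p (a *: x) = a * p x) ->
  (forall x, 0 <=v x -> 0 <= p x <= f x) ->
  exists g : dual E, forall x, 0 <=v x -> g x = p x.
Proof.
move=> pD pZ pf; pose q x : R^o := p (vjoin x 0) - p (vjoin x 0 - x).
have qB x y : 0 <=v x -> 0 <=v y -> q (x - y) = p x - p y.
  move=> x0 y0; rewrite /q; have := vpos_ge0 (x - y); have := vneg_ge0 (x - y).
  set u := vjoin _ _ => n0 u0; apply/eqP; rewrite subr_eq addrAC eq_sym subr_eq.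
  by rewrite -!pD// opprB addrCA subrKC addrC.
have p0 : p 0 = 0.
  by rewrite -(scale0r (0 : E)) pZ ?mul0r//; exact: vle_refl.
have qp x : 0 <=v x -> q x = p x.
  by move=> x0; rewrite -[x in LHS]subr0 qB ?p0 ?subr0//; exact: vle_refl.
have dec x : exists y z, [/\ 0 <=v y, 0 <=v z & x = y - z].
  exists (vjoin x 0), (vjoin x 0 - x); split; [exact: vpos_ge0|exact: vneg_ge0|].
  by rewrite subKr.
have qD x y : q (x + y) = q x + q y.
  have [a [b [a0 b0 ->]]] := dec x; have [c [d [c0 d0 ->]]] := dec y.
  have -> : (a - b) + (c - d) = (a + c) - (b + d) by rewrite opprD addrACA.
  rewrite !qB ?pD//; [by lra|exact: vaddr_ge0|exact: vaddr_ge0].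
have qN x : q (- x) = - q x.
  have [a [b [a0 b0 ->]]] := dec x.
  by rewrite opprB !qB// opprB.
have qZ a x : 0 <= a -> q (a *: x) = a * q x.
  move=> a0; have [b [c [b0 c0 ->]]] := dec x.
  by rewrite scalerBr !qB ?pZ// ?mulrBr//; exact: vleZ.
have ql : linear q.
  move=> a x y; rewrite qD; congr (_ + _).
  have [a0|a0] := leP 0 a; first exact: qZ.
  rewrite -[a *: x]opprK -scaleNr qN qZ ?oppr_ge0 ?(ltW a0)//.
  by rewrite mulNr opprK.
have qb : q \in bounded_functional E.
  apply/bounded_functionalP; split => //; exists (`|f| + `|f|) => [|x].
    exact: addr_ge0.
  suff le1 y : q y <= (`|f| + `|f|) * `|y|.
    by rewrite ler_norml le1 andbT lerNl -qN -(normrN x).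
  have ye : y <=v vabs y := vjoinl _ _.
  have := qB _ _ (vabs_ge0 y) (proj2 (vsub_ge0 _ _) ye); rewrite subKr => ->.
  have /andP[_ h1] := pf _ (vabs_ge0 y).
  have /andP[h2 _] := pf _ (proj2 (vsub_ge0 _ _) ye).
  have h3 := le_trans (ler_norm _) (ler_dual f (vabs y)).
  rewrite norm_vabs in h3.
  have h4 : 0 <= `|f| * `|y| by exact: mulr_ge0.
  by rewrite mulrDl; lra.
by exists (Dual qb).
Qed.

(* For [f >= 0], the component of [f] in the band dual to the ideal generated
   by [z >= 0]. *)
Definition component_fun f z x : R :=
  sup [set (f (vmeet x (c *: z)) : R) | c in [set c : R | 0 <= c]].

Section Component.
Variables (f : dual E) (f0 : 0 <=v f).

Lemma component_ub z x (c : R) : 0 <= c ->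
  f (vmeet x (c *: z)) <= component_fun f z x.
Proof.
move=> c0; apply: ub_le_sup; last by exists c.
by exists (f x) => _ [d _ <-]; apply: dual_mono f0 _; exact: vmeetl.
Qed.

Lemma component_le z x (M : R) :
  (forall c : R, 0 <= c -> f (vmeet x (c *: z)) <= M) ->
  component_fun f z x <= M.
Proof.
move=> h; apply: ge_sup; first by exists (f (vmeet x (0 *: z))); exists 0 => /=.
by move=> _ [c c0 <-]; exact: h.
Qed.

(** Additivity: one inequality is [vmeetDr]; for the other, truncations at [c *: z] and [d *: z] add
    up to one below [(d + c) *: z]. Homogeneity: truncating [a *: x] at [c *: z] amounts to
    truncating [x] at [(a^-1 * c) *: z], and the case of [a^-1] gives the reverse inequality. *)
Lemma component_exists z : 0 <=v z ->
  exists g : dual E, forall x, 0 <=v x -> g x = component_fun f z x.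
Proof.
move=> z0; have cz c : 0 <= c -> 0 <=v c *: z by move=> c0; exact: vleZ.
apply: (@dual_extend _ f).
- move=> x y x0 y0; have xy0 := vaddr_ge0 x0 y0.
  apply/le_anti/andP; split.
    apply: component_le => c c0.
    apply: (@le_trans _ _ (f (vmeet x (c *: z)) + f (vmeet y (c *: z)))).
      rewrite -linearD; apply: dual_mono => //.
      rewrite vmeetC [vmeet x _]vmeetC [vmeet y _]vmeetC.
      by apply: vmeetDr => //; exact: cz.
    by rewrite lerD// component_ub.
  rewrite -lerBrDr; apply: component_le => c c0; rewrite lerBrDr addrC.
  rewrite -lerBrDr; apply: component_le => d d0; rewrite lerBrDr -linearD.
  have cd0 : 0 <= d + c by exact: addr_ge0.
  apply: le_trans (component_ub z (x + y) cd0); apply: dual_mono => //.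
  apply/vmeetP; split; last by rewrite scalerDl; apply: vleD; exact: vmeetr.
  by rewrite addrC; apply: vleD; exact: vmeetl.
- have le a x : 0 < a -> 0 <=v x -> component_fun f z (a *: x) <= a * component_fun f z x.
    move=> a0 x0; have ai0 : 0 <= a^-1 by rewrite invr_ge0 ltW.
    apply: component_le => c c0; rewrite mulrC -ler_pdivrMr// mulrC -[_ * _]linearZ.
    have c'0 : 0 <= a^-1 * c by exact: mulr_ge0.
    apply: le_trans (component_ub z x c'0); apply: dual_mono => //.
    apply/vmeetP; split.
      rewrite -[X in vle _ X](scalerK (lt0r_neq0 a0)).
      by apply: ler_vZ => //; exact: vmeetl.
    by rewrite -scalerA; apply: ler_vZ => //; exact: vmeetr.
  move=> a x; rewrite le_eqVlt => /predU1P[<-|a0] x0.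
    rewrite scale0r mul0r; apply/le_anti/andP; split.
      apply: component_le => c c0; rewrite -(linear0 f); apply: dual_mono => //.
      exact: vmeetl.
    apply: le_trans (component_ub z 0 (lexx 0)).
    by apply: dual_ge0 => //; apply: vmeet_ge0; [exact: vle_refl|exact: cz].
  apply/le_anti; rewrite le//= -ler_pdivlMl//.
  rewrite -{1}[x](scalerK (lt0r_neq0 a0)) le ?invr_gt0//.
  by apply: vleZ => //; exact: ltW.
- move=> x x0; apply/andP; split.
    apply: le_trans (component_ub z x (lexx 0)).
    by apply: dual_ge0 => //; apply: vmeet_ge0 => //; exact: cz.
  by apply: component_le => c c0; apply: dual_mono => //; exact: vmeetl.
Qed.

Definition component z (z0 : 0 <=v z) : dual E :=
  projT1 (cid (component_exists z0)).

Lemma componentE z (z0 : 0 <=v z) x : 0 <=v x ->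
  component z0 x = component_fun f z x.
Proof. by rewrite /component; case: cid => g /= gE; exact: gE. Qed.

Lemma component_ge0 z (z0 : 0 <=v z) : 0 <=v component z0.
Proof.
move=> x x0; rewrite componentE//; apply: le_trans (component_ub z x (lexx 0)).
by apply: dual_ge0 => //; apply: vmeet_ge0 => //; exact: vleZ.
Qed.

Lemma component_le_self z (z0 : 0 <=v z) : component z0 <=v f.
Proof.
move=> x x0; rewrite componentE//; apply: component_le => c c0.
by apply: dual_mono => //; exact: vmeetl.
Qed.

Lemma component_mono y z (y0 : 0 <=v y) (z0 : 0 <=v z) : y <=v z ->
  component y0 <=v component z0.
Proof.
move=> yz x x0; rewrite !componentE//; apply: component_le => c c0.
apply: le_trans (component_ub z x c0); apply: dual_mono => //.
by apply: vmeet_mono; [exact: vle_refl|exact: ler_vZ].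
Qed.

(** The truncation at [1 *: z] already leaves [x] unchanged. *)
Lemma component_id z (z0 : 0 <=v z) x : 0 <=v x -> x <=v z ->
  component z0 x = f x.
Proof.
move=> x0 xz; apply/le_anti; rewrite (component_le_self z0 x0)//=.
rewrite componentE//; apply: le_trans (component_ub z x ler01).
by apply: dual_mono => //; rewrite scale1r; apply/vmeetP; split => //; exact: vle_refl.
Qed.

Lemma component_disj z (z0 : 0 <=v z) x : 0 <=v x -> vmeet x z = 0 ->
  component z0 x = 0.
Proof.
move=> x0 xz; apply/le_anti; rewrite (component_ge0 z0 x0) andbT.
rewrite componentE//; apply: component_le => c c0.
by rewrite vmeetZ_eq0// linear0.
Qed.

End Component.

End OrderDual.

Lemma bounded_setP {R : realType} {V : normedModType R} (A : set V) :
  bounded_set A <-> exists M : R, forall x, A x -> `|x| <= M.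
Proof.
split=> [/pinfty_ex_gt0[M _ AM]|[M AM]]; first by exists M.
by exists M; split=> [|r Mr x Ax]; [exact: num_real|exact: le_trans (AM x Ax) (ltW Mr)].
Qed.

(** * Disjoint sequences when the dual is a KB-space *)

Section DisjointSequences.
Context {R : realType} {E : banachLatticeType R}.

Lemma disjoint_seq_sum (x : nat -> E) n : disjoint_seq x ->
  vmeet (vabs (x n)) (\sum_(i < n) vabs (x i)) = 0.
Proof.
(* Positivity of the sum is carried along the induction, since [vmeetD_eq0] asks for it. *)
move=> dx; have : 0 <=v \sum_(i < n) vabs (x i) /\
    vmeet (vabs (x n)) (\sum_(i < n) vabs (x i)) = 0; last by case.
apply: (big_ind (fun z => 0 <=v z /\ vmeet (vabs (x n)) z = 0)).
- split; first exact: vle_refl.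
  by apply: vle_anti (vmeet_ge0 (vabs_ge0 _) (vle_refl _)); exact: vmeetr.
- move=> a b [a0 xa] [b0 xb]; split; first exact: vaddr_ge0.
  by apply: vmeetD_eq0 => //; exact: vabs_ge0.
- by move=> i _; split; [exact: vabs_ge0|rewrite dx// gtn_eqF].
Qed.

(* The components of [|f|] along the partial sums of [|x n|] increase and stay
   below [|f|], so they are Cauchy in a KB-space; the [n]-th increment takes
   the value [|f| |x n|] at [|x n|]. *)
Lemma KB_dual_disjoint_weakly_null (x : nat -> E) : KB_space (dual E) ->
  disjoint_seq x -> bounded_set (range x) -> weakly_null x.
Proof.
move=> KB dx /bounded_setP[M xM] f.
have M0 : 0 <= M by apply: le_trans (xM (x 0%N) _) => //; exists 0%N.
pose z n := \sum_(i < n) vabs (x i).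
have z0 n : 0 <=v z n.
  apply: (big_ind (fun z => 0 <=v z)); [exact: vle_refl|exact: vaddr_ge0|].
  by move=> i _; exact: vabs_ge0.
have f0 : 0 <=v vabs f := vabs_ge0 f.
pose G n := component f0 (z0 n).
have zS n : z n.+1 = z n + vabs (x n) by rewrite /z big_ord_recr.
have /cvg_ex[L GL] : cvg (G @ \oo).
  apply: KB => [n|n|]; first exact: component_ge0.
    by apply: component_mono; rewrite zS; apply: vler_addl; exact: vabs_ge0.
  apply/bounded_setP; exists `|vabs f| => _ [n _ <-].
  by apply: vle_norm_ge0; [exact: component_ge0|exact: component_le_self].
have dG : G n.+1 - G n @[n --> \oo] --> (0 : dual E).
  by rewrite -(subrr L); apply: cvgB => //; rewrite (cvg_shiftS G).
apply/cvgr0Pnorm_lt => e e0.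
have d0 : 0 < e / (M + 1) by rewrite divr_gt0// ltr_wpDl.
have /cvgr0Pnorm_lt/(_ _ d0) := dG; apply: filterS => n dn.
have xnM : `|x n| <= M by apply: xM; exists n.
apply: le_lt_trans (dual_vabs f (x n)) _.
have <- : (G n.+1 - G n) (vabs (x n)) = vabs f (vabs (x n)).
  have x0 := vabs_ge0 (x n).
  rewrite dualD dualN /G component_id//; last first.
    by rewrite zS addrC; apply: vler_addl.
  by rewrite component_disj ?subr0//; exact: disjoint_seq_sum.
apply: le_lt_trans (ler_norm _) _; apply: le_lt_trans (ler_dual _ _) _.
rewrite norm_vabs; rewrite ltr_pdivlMr ?ltr_wpDl// in dn.
apply: le_lt_trans dn; rewrite ler_wpM2l//; apply: le_trans xnM _.
by rewrite lerDl.
Qed.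

(** * Disjointification and the sliding hump *)

Lemma vseries_ge (w : nat -> E) : (forall n, 0 <=v w n) ->
  cvgn (series w) -> forall k, w k <=v limn (series w).
Proof.
(* The partial sums from [k.+1] on dominate [w k], and the positive cone is closed. *)
move=> w0 cw k; apply/vsub_ge0.
apply: (@vcone_closed _ _ (fun n => series w n - w k)).
  by apply: cvgB => //; exact: cvg_cst.
exists k.+1 => // n /= kn; apply/vsub_ge0.
rewrite /series /= (big_cat_nat _ kn)//= big_nat_recr//=.
have sum0 a b : 0 <=v \sum_(a <= i < b) w i.
  apply: (big_ind (fun z => 0 <=v z)); [exact: vle_refl|exact: vaddr_ge0|].
  by move=> i _.
rewrite addrAC addrC; apply: vler_addl; exact: vaddr_ge0.
Qed.

(** The bound is the sum of the series of [2^-1 ^+ k *: X k], which converges absolutely. *)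
Lemma vgeom_dominated (X : nat -> E) :
  (forall k, 0 <=v X k) -> (forall k, `|X k| <= 1) ->
  exists x, 0 <=v x /\ forall k, 2^-1 ^+ k *: X k <=v x.
Proof.
move=> X0 X1; pose w k : E := 2^-1 ^+ k *: X k.
have q0 k : 0 <= 2^-1 ^+ k :> R by rewrite exprn_ge0// invr_ge0.
have w0 k : 0 <=v w k by apply: vleZ.
have cw : cvgn (series w).
  apply: normed_cvg; apply: (@series_le_cvg _ _ (geometric 1 2^-1)) => //.
  - by move=> n; exact: normr_ge0.
  - by move=> n /=; rewrite mul1r.
  - by move=> n /=; rewrite mul1r normrZ ger0_norm// ler_piMr.
  - by apply: is_cvg_geometric_series; rewrite ger0_norm ?invr_ge0//; lra.
have wx := vseries_ge w0 cw; exists (limn (series w)); split=> //.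
exact: vle_trans (w0 0%N) (wx 0%N).
Qed.

(** For [n < m], [X n <= s m] puts the [m]-th term below the positive part of [X m - 4 ^+ m *: X n],
    while [2^-1 ^+ m *: X m <= x] puts the [n]-th term below that of [X n - (4 ^+ m)^-1 *: X m];
    these are disjoint by [vpos_scaled_disj]. *)
Lemma disjointify (X s : nat -> E) (x : E) :
  (forall k, 0 <=v X k) -> (forall k, 0 <=v s k) ->
  (forall i k, (i < k)%N -> X i <=v s k) ->
  (forall k, 2^-1 ^+ k *: X k <=v x) ->
  disjoint_seq (fun k => vjoin (X k - 4 ^+ k *: s k - 2^-1 ^+ k *: x) 0).
Proof.
move=> X0 s0 Xs Xx; set u := fun k => _.
have q0 k : 0 <= 2^-1 ^+ k :> R by rewrite exprn_ge0// invr_ge0.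
have c0 k : 0 < 4 ^+ k :> R by rewrite exprn_gt0.
have x0 : 0 <=v x by apply: vle_trans (Xx 0%N); apply: vleZ.
have u0 k : 0 <=v u k by exact: vjoinr.
have main n m : (n < m)%N -> vmeet (u m) (u n) = 0.
  move=> nm; apply: vmeet_eq0 (vpos_scaled_disj (X m) (X n) (c0 m)) => //.
    apply: vpos_mono; apply: vle_trans (vler_subl _ _) _; first exact: vleZ.
    apply: vleD; first exact: vle_refl.
    by apply: vleN2; apply: ler_vZ; [exact: ltW|exact: Xs].
  apply: vpos_mono; rewrite addrAC; apply: vle_trans (vler_subl _ _) _.
    by apply: vleZ => //; exact: ltW.
  apply: vleD; first exact: vle_refl.
  apply: vleN2; apply: (@vle_trans _ _ (2^-1 ^+ n *: (2^-1 ^+ m *: X m))).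
    rewrite scalerA; apply: ler_vZl => //.
    (* The base [4 = 2 * 2] leaves one factor [2^-1 ^+ m] for [X m] and one to compare with
       [2^-1 ^+ n]. *)
    have -> : (4 ^+ m)^-1 = 2^-1 ^+ m * 2^-1 ^+ m :> R.
      by rewrite -exprMn -exprVn; congr (_ ^+ _); lra.
    rewrite ler_wpM2r//; apply: ler_wiXn2l; [by rewrite invr_ge0|by lra|].
    exact: ltnW.
  by apply: ler_vZ.
move=> n m; rewrite !vabs_id// neq_ltn => /orP[|] nm; last exact: main.
by rewrite vmeetC; exact: main.
Qed.

(* A sequence [g n] not tending to [0] in norm is large at positive unit
   vectors [X k]; as [|g n| --> 0] pointwise, [X k] can be chosen with
   [|g (phi k)|] negligible at the previous ones, and then [disjointify] turns
   [X k] into a disjoint sequence at little cost. *)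
Lemma dual_cvg0_disjoint (g : nat -> dual E) :
  wstar_null (fun n => vabs (g n)) ->
  (forall (phi : nat -> nat) (y : nat -> E), (forall k, (k <= phi k)%N) ->
     disjoint_seq y -> bounded_set (range y) ->
     g (phi k) (y k) @[k --> \oo] --> (0 : R)) ->
  g n @[n --> \oo] --> (0 : dual E).
Proof.
move=> h0 gy; apply: contrapT => /cvgr0Pnorm_lt/existsNP[e /not_implyP[e0 ge]].
(* Budget: [|g|] exceeds [4 * d] at [X k]; the two subtracted terms and the passage from [|g|] to
   [g] cost at most [d] each, so [g (phi k) (y k)] exceeds [d]. The choice [e / 8] keeps [4 * d]
   strictly below [e]. *)
pose d := e / 8; have d0 : 0 < d by rewrite divr_gt0.
have large N : exists2 n, (N <= n)%N & e <= `|g n|.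
  apply: contrapT => nl; apply: ge; exists N => // n /= Nn; rewrite ltNge.
  by apply/negP => le; apply: nl; exists n.
(* A state holds a lower bound for the next index and the vector at which the next modulus must be
   below [d]. *)
have step (Ns : nat * E) : exists p : nat * E,
    [/\ (Ns.1 <= p.1)%N, 0 <=v p.2, `|p.2| <= 1,
        4 * d < vabs (g p.1) p.2 & vabs (g p.1) Ns.2 < d].
  case: Ns => N s /=; have := h0 s => /cvgr0Pnorm_lt/(_ _ d0)[N' _ sN'].
  have [n nN en] := large (maxn N N'); rewrite geq_max in nN.
  have /andP[Nn N'n] := nN.
  have ed : 4 * d < `|g n| by apply: lt_le_trans en; rewrite /d; lra.
  have [_ [x x1 <-] gx] := sup_gt (proj1 (dual_norm_has_sup (g n))) ed.
  exists (n, vabs x) => /=; split=> //; first exact: vabs_ge0.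
  - by rewrite norm_vabs.
  - exact: lt_le_trans gx (dual_vabs _ _).
  - exact: le_lt_trans (ler_norm _) (sN' _ N'n).
have [F FP] := choice step.
(* The state at stage [k] holds [4 ^+ k *: s k], the very term that [disjointify] subtracts, so the
   growing factor is already paid for. *)
pose s := fix s k : E :=
  if k is k'.+1 then s k' + (F (k', 4 ^+ k' *: s k')).2 else 0.
pose phi k := (F (k, 4 ^+ k *: s k)).1; pose X k := (F (k, 4 ^+ k *: s k)).2.
have sS k : s k.+1 = s k + X k by [].
have P k := FP (k, 4 ^+ k *: s k).
have X0 k : 0 <=v X k by have [] := P k.
have X1 k : `|X k| <= 1 by have [] := P k.
have s0 k : 0 <=v s k.
  elim: k => [|k IH]; first exact: vle_refl.
  by rewrite sS; exact: vaddr_ge0.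
have Xs i k : (i < k)%N -> X i <=v s k.
  elim: k => // k IH; rewrite ltnS leq_eqVlt sS => /predU1P[->|/IH ik].
    by rewrite addrC; apply: vler_addl.
  by apply: vle_trans ik _; apply: vler_addl.
have [x [x0 Xx]] := vgeom_dominated X0 X1.
have du := disjointify X0 s0 Xs Xx; set u := fun k => _ in du.
have u0 k : 0 <=v u k by exact: vjoinr.
have q0 k : 0 <= 2^-1 ^+ k :> R by rewrite exprn_ge0// invr_ge0.
have s40 k : 0 <=v 4 ^+ k *: s k by apply: vleZ; rewrite ?exprn_ge0.
have uX k : u k <=v X k.
  apply: vpos_le => //; apply: vle_trans (vler_subl _ _) _; first exact: vleZ.
  exact: vler_subl.
(* Only the modulus is known to be large at [u k]; a near-maximiser [y k] with [|y k| <= u k] makes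
   [g (phi k)] itself large and inherits disjointness and boundedness. *)
have apx k := vabs_dual_approx (g (phi k)) d0 (u0 k).
have [y yP] := choice (fun k => let: ex_intro2 v a b := apx k in
  ex_intro (fun v => vabs v <=v u k /\ vabs (g (phi k)) (u k) - d < g (phi k) v)
    v (conj a b)).
have yu k : vabs (y k) <=v u k by have [] := yP k.
have kphi k : (k <= phi k)%N by have [] := P k.
have : g (phi k) (y k) @[k --> \oo] --> (0 : R).
  apply: gy => //.
    move=> n m nm; apply: vmeet_eq0 (du n m nm); try exact: vabs_ge0.
      by rewrite [vabs (u n)]vabs_id.
    by rewrite [vabs (u m)]vabs_id.
  apply/bounded_setP; exists 1 => _ [k _ <-]; apply: le_trans (X1 k).
  rewrite -(norm_vabs (y k)); apply: vle_norm_ge0; first exact: vabs_ge0.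
  exact: vle_trans (yu k) (uX k).
move=> /cvgr0Pnorm_lt/(_ _ d0)[N1 _ gN1].
(* The vector [x] does not depend on [k], so its cost is small once [phi k >= k] has passed [N2]. *)
have := h0 x => /cvgr0Pnorm_lt/(_ _ d0)[N2 _ gN2].
pose k := maxn N1 N2.
have gy1 := gN1 k (leq_maxl _ _).
have gx := gN2 (phi k) (leq_trans (leq_maxr _ _) (kphi k)).
have hx := le_lt_trans (ler_norm _) gx; have hy := le_lt_trans (ler_norm _) gy1.
have [_ _ _ hX hs] := P k; have [_ guy] := yP k.
have {}hX : 4 * d < vabs (g (phi k)) (X k) by [].
have {}hs : vabs (g (phi k)) (4 ^+ k *: s k) < d by [].
have hp : 0 <=v vabs (g (phi k)) := vabs_ge0 _.
move: (vabs (g (phi k))) hX hs hx hp guy {gx} => h hX hs hx hp guy.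
have := dual_mono hp (vjoinl (X k - 4 ^+ k *: s k - 2^-1 ^+ k *: x) 0).
rewrite -/(u k) !linearB /=.
have -> : h (2^-1 ^+ k *: x) = 2^-1 ^+ k * h x.
  exact: linearZ.
have : 2^-1 ^+ k * h x <= h x.
  by apply: ler_piMl; [exact: dual_ge0|apply: exprn_ile1; [rewrite invr_ge0|lra]].
lra.
Qed.

End DisjointSequences.

(** * Uniform boundedness, adjoints and limited operators *)

Lemma wstar_null_bounded {R : realType} {X : completeNormedModType R}
    (f : nat -> dual X) : wstar_null f -> exists M : R, forall n, `|f n| <= M.
Proof.
move=> f0; pose F := [set (f n : X -> R^o) | n in setT].
have FL h : F h -> bounded_fun_norm h /\ linear h.
  move=> [n _ <-]; split; last exact: dual_linear.
  move=> r; exists (`|f n| * r) => x xr; apply: le_trans (ler_dual _ _) _.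
  by rewrite ler_wpM2l.
have Fp : pointwise_bounded F.
  move=> x; have cx : cvg (f n x @[n --> \oo]) by apply/cvg_ex; exists 0; exact: f0.
  have [M _ fM] := pinfty_ex_gt0 (cvg_seq_bounded cx).
  by exists M => _ [n _ <-]; exact: fM.
(* At radius [1] the uniform bound is a bound on the dual norms. *)
have [M FM] := Banach_Steinhauss FL Fp 1.
exists (Num.max M 0) => n; rewrite dual_normE; apply: ge_sup.
  by case: (dual_norm_has_sup (f n)).
by move=> _ [x x1 <-]; rewrite le_max FM//; exists n.
Qed.

Section LimitedOperators.
Context {R : realType} {E : banachLatticeType R}.

Lemma dual_compP {X Y : normedModType R} (T : X -> Y) (f : dual Y) :
  bounded_operator T -> (f \o T : X -> R^o) \in bounded_functional X.
Proof.
move=> /bounded_operatorP[lT [M M0 TM]]; apply/bounded_functionalP; split.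
  by move=> a x y /=; rewrite lT linearP.
exists (`|f| * M) => [|x /=]; first exact: mulr_ge0.
by apply: le_trans (ler_dual _ _) _; rewrite -mulrA ler_wpM2l.
Qed.

(** This is the adjoint of [T] at [f], packaged in [dual X] so that its norm and, over a lattice,
    its modulus are available. *)
Definition dual_comp {X Y : normedModType R} (T : X -> Y)
  (bT : bounded_operator T) (f : dual Y) : dual X := Dual (dual_compP f bT).

(** The supremum of [|f n (T x)|] over the unit ball is the norm of [f n \o T], so norm convergence
    to zero is uniform convergence on the image of the ball. *)
Lemma limited_operator_of_dual {X Y : normedModType R} (T : X -> Y)
    (bT : bounded_operator T) :
  (forall f : nat -> dual Y, wstar_null f ->
     dual_comp bT (f n) @[n --> \oo] --> (0 : dual X)) ->
  limited_operator T.
Proof.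
move=> adj; split.
  have [_ [M M0 TM]] := proj1 (bounded_operatorP T) bT.
  apply/bounded_setP; exists M => _ [x x1 <-]; apply: le_trans (TM x) _.
  by rewrite ler_piMr.
move=> f /adj f0 P /uniform_nbhs[B []].
rewrite -entourage_ballE => -[e /= e0 eB] BP.
have /cvgr0Pnorm_lt/(_ _ e0) := f0; apply: filterS => n fn; apply: BP => _ [x x1 <-].
apply: eB; rewrite /= -ball_normE /= sub0r normrN.
apply: le_lt_trans fn; apply: le_trans (ler_dual (dual_comp bT (f n)) x) _.
by rewrite ler_piMr.
Qed.

(** The core shared by both claims: along a disjoint bounded [y], [f (phi k) (T (y k))] is at most
    [M] times the norm of [T (y k)], with [M] bounding all norms of [f n]. *)
Lemma M_weakly_compact_limited {Y : completeNormedModType R} (T : E -> Y)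
    (bT : bounded_operator T) :
  M_weakly_compact T ->
  (forall f : nat -> dual Y, wstar_null f ->
     wstar_null (fun n => vabs (dual_comp bT (f n)))) ->
  limited_operator T.
Proof.
move=> MT habs; apply: (@limited_operator_of_dual _ _ _ bT) => f f0.
apply: dual_cvg0_disjoint; first exact: habs.
move=> phi y _ dy /(MT y dy) Ty0; have [M fM] := wstar_null_bounded f0.
apply/norm_cvg0P; apply: (@squeeze_cvgr _ _ _ _ (cst 0) (fun k => M * `|T (y k)|)).
- near=> k; rewrite normr_ge0 /=; apply: le_trans (ler_dual _ _) _.
  by rewrite ler_wpM2r.
- exact: cvg_cst.
- by rewrite -[X in _ --> X](mulr0 M); apply: cvgMr.
Unshelve. all: by end_near. Qed.

End LimitedOperators.

Lemma wstar_null_comp {R : realType} {X Y : normedModType R} (T : X -> Y)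
    (bT : bounded_operator T) (f : nat -> dual Y) :
  wstar_null f -> wstar_null (fun n => dual_comp bT (f n)).
Proof. by move=> f0 x; exact: f0. Qed.

(** At a positive [x] the moduli are squeezed between [0] and [|f n| (T x)]; any other vector is a
    difference of two positive ones. *)
Lemma wstar_null_vabs_comp {R : realType} {E F : banachLatticeType R}
    (T : E -> F) (bT : bounded_operator T) (f : nat -> dual F) :
  positive_operator T -> wstar_null (fun n => vabs (f n)) ->
  wstar_null (fun n => vabs (dual_comp bT (f n))).
Proof.
move=> pT f0.
have le n : vabs (dual_comp bT (f n)) <=v dual_comp bT (vabs (f n)).
  apply: vabs_le => x x0; first exact: (vjoinl (f n) _ (T x) (pT x x0)).
  exact: (vjoinr (f n) (- f n) (T x) (pT x x0)).
have pos x : 0 <=v x -> vabs (dual_comp bT (f n)) x @[n --> \oo] --> (0 : R).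
  move=> x0; apply: (@squeeze_cvgr _ _ _ _ (cst 0) (fun n => vabs (f n) (T x))).
  - near=> n; rewrite (le n x x0) andbT.
    exact: (dual_ge0 (vabs_ge0 _) x0).
  - exact: cvg_cst.
  - exact: f0.
move=> x; have -> : (fun n => vabs (dual_comp bT (f n)) x) =
    (fun n => vabs (dual_comp bT (f n)) (vjoin x 0) -
              vabs (dual_comp bT (f n)) (vjoin x 0 - x)).
  by apply/funext => n; rewrite -linearB subKr.
rewrite -[X in _ --> X](subr0 (0 : R)).
by apply: cvgB; apply: pos; [exact: vpos_ge0|exact: vneg_ge0].
Unshelve. all: by end_near. Qed.

Theorem theorem2p9 (R : realType) (E F : banachLatticeType R) :
  (KB_space (dual E) -> wstar_seq_continuous_lattice_ops F ->
     forall T : E -> F, bounded_operator T -> positive_operator T ->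
       almost_Dunford_Pettis T -> limited_operator T) /\
  (wstar_seq_continuous_lattice_ops E ->
     forall T : E -> F, bounded_operator T ->
       M_weakly_compact T -> limited_operator T).
Proof.
split=> [KB wF T bT pT aT|wE T bT MT]; apply: (@M_weakly_compact_limited _ _ _ T bT).
- by move=> x dx bx; apply: aT => //; exact: KB_dual_disjoint_weakly_null.
- by move=> f /wF; exact: wstar_null_vabs_comp.
- exact: MT.
(* Composition with [T] comes first here: [f n \o T] is weak*-null on [E], and the moduli are taken
   afterwards, so positivity of [T] is replaced by the hypothesis on the dual of [E]. *)
- by move=> f /(wstar_null_comp bT)/wE.
Qed.
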